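(* Suppose each $f_i$ is strongly convex with constant $\mu_i>0$ and differentiable, $i=1,\dots,m$. Suppose the optimal values of the primal problem (P) and the dual problem (D) are attained, at $\mathbf{y}^\star$ and $\boldsymbol{\lambda}^\star$ respectively, and strong duality $f(\mathbf{y}^\star)=g(\boldsymbol{\lambda}^\star)$ holds. Let $\mu=\min_i\mu_i$, $S=\sqrt{(4+4\cos(\pi/m))/\mu}$, and for $\boldsymbol{\lambda}\in\mathbb{R}^{n(m-1)}$ let $$\mathbf{y}(\boldsymbol{\lambda})=\arg\min_{\mathbf{y}\in\bar{\mathcal{Y}}}\left(f(\mathbf{y})+\boldsymbol{\lambda}^{T}\mathbf{A}\mathbf{y}\right).$$ Then for all $\boldsymbol{\lambda}\in\mathbb{R}^{n(m-1)}$: 1. $g(\boldsymbol{\lambda}^\star)-g(\boldsymbol{\lambda})\ge\frac{\mu}{2}\|\mathbf{y}(\boldsymbol{\lambda})-\mathbf{y}^\star\|^2$. 2. $g(\boldsymbol{\lambda}^\star)-g(\boldsymbol{\lambda})+S\,\|\boldsymbol{\lambda}\|\sqrt{g(\boldsymbol{\lambda}^\star)-g(\boldsymbol{\lambda})}\ge|f(\mathbf{y}(\boldsymbol{\lambda}))-f(\mathbf{y}^\star)|$.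
   Context: Let $m\ge2$, $n\ge1$ be integers, $\mathcal{Y}\subseteq\mathbb{R}^n$ a closed convex set, and $f_i:\mathbb{R}^n\to\mathbb{R}$, $i=1,\dots,m$, strictly convex closed functions. For $\mathbf{y}=(\mathbf{y}_1,\dots,\mathbf{y}_m)\in(\mathbb{R}^n)^m=\mathbb{R}^{nm}$ put $f(\mathbf{y})=\sum_{i=1}^m f_i(\mathbf{y}_i)$, let $\bar{\mathcal{Y}}=\mathcal{Y}^m$, and $\mathbf{A}\mathbf{y}=(\mathbf{y}_1-\mathbf{y}_2,\dots,\mathbf{y}_{m-1}-\mathbf{y}_m)\in\mathbb{R}^{n(m-1)}$. Primal problem (P): minimize $f(\mathbf{y})$ subject to $\mathbf{y}\in\bar{\mathcal{Y}}$, $\mathbf{A}\mathbf{y}=\mathbf{0}$. Dual function: $g(\boldsymbol{\lambda})=\inf_{\mathbf{y}\in\bar{\mathcal{Y}}}\big[f(\mathbf{y})+\boldsymbol{\lambda}^{T}\mathbf{A}\mathbf{y}\big]$. Dual problem (D): maximize $g(\boldsymbol{\lambda})$ over $\boldsymbol{\lambda}\in\mathbb{R}^{n(m-1)}$. Norms are Euclidean. A function $\varphi$ is strongly convex with constant $\sigma>0$ if $\varphi-\frac{\sigma}{2}\|\cdot\|^2$ is convex. *)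

(* Defs.v *)
From HB Require Import structures.
From mathcomp Require Export all_boot all_order all_algebra.
From mathcomp Require Export all_classical all_reals all_analysis.

Set Implicit Arguments.
Unset Strict Implicit.
Unset Printing Implicit Defensive.

Export Order.TTheory GRing.Theory Num.Theory.
Export numFieldNormedType.Exports.

Open Scope classical_set_scope.
Open Scope ring_scope.

(* A point (y_1, ..., y_m) of (R^n)^m is an m x n matrix whose i-th row is y_i,
   and lambda in R^(n(m-1)) is an (m-1) x n matrix. *)

Definition edot (R : realType) (p q : nat) (u v : 'M[R]_(p, q)) : R :=
  \sum_i \sum_j u i j * v i j.

(* The norm `|_| that the library puts on matrices is the sup norm. *)
Definition enorm (R : realType) (p q : nat) (u : 'M[R]_(p, q)) : R :=
  Num.sqrt (edot u u).

Definition strictly_convex (R : realType) (E : lmodType R) (phi : E -> R) :=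
  forall (x y : E) (t : R), x != y -> 0 < t -> t < 1 ->
    phi (t *: x + (1 - t) *: y) < t * phi x + (1 - t) * phi y.

Definition strongly_convex (R : realType) (n : nat) (sigma : R)
    (phi : 'rV[R]_n -> R) :=
  convex_function setT (fun x : 'rV[R]_n => phi x - sigma / 2 * enorm x ^+ 2).

Definition closed_function (R : realType) (n : nat) (phi : 'rV[R]_n -> R) :=
  closed [set p : 'rV[R]_n * R | phi p.1 <= p.2].

Definition argmin (d : Order.disp_t) (V : porderType d) (T : Type)
    (D : set T) (F : T -> V) : set T :=
  [set x | D x /\ forall y, D y -> (F x <= F y)%O].

Definition argmax (d : Order.disp_t) (V : porderType d) (T : Type)
    (D : set T) (F : T -> V) : set T :=
  [set x | D x /\ forall y, D y -> (F y <= F x)%O].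

Lemma ord_succ_proof (m : nat) (i : 'I_m.-1) : (i.+1 < m)%N.
Proof. by rewrite -ltn_predRL. Qed.

Definition ord_here (m : nat) (i : 'I_m.-1) : 'I_m := widen_ord (leq_pred m) i.
Definition ord_succ (m : nat) (i : 'I_m.-1) : 'I_m := Ordinal (ord_succ_proof i).

Section ConsensusProblem.
Variables (R : realType) (m n : nat).
Variables (Y : set 'rV[R]_n) (f : 'I_m -> 'rV[R]_n -> R).

Definition fsum (y : 'M[R]_(m, n)) : R := \sum_i f i (row i y).

Definition Ybar : set 'M[R]_(m, n) := [set y | forall i, Y (row i y)].

Definition Aop (y : 'M[R]_(m, n)) : 'M[R]_(m.-1, n) :=
  \matrix_(i < m.-1) (row (ord_here i) y - row (ord_succ i) y).

Definition feasible : set 'M[R]_(m, n) := Ybar `&` [set y | Aop y = 0].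

Definition lagrangian (l : 'M[R]_(m.-1, n)) (y : 'M[R]_(m, n)) : R :=
  fsum y + edot l (Aop y).

Definition dual (l : 'M[R]_(m.-1, n)) : \bar R :=
  ereal_inf [set (lagrangian l y)%:E | y in Ybar].

End ConsensusProblem.

(* Main.v *)
Require Import Defs.
From mathcomp Require Import ring lra.

(* The Lagrangian is separable: moving [A] to the other side of the inner
   product, it is a sum over [i] of the [mu_i]-strongly convex functions
   [f_i + <c_i, .>] of [y_i].  Each has a minimizer on [Y] by compactness of its
   sublevel sets, and grows at least quadratically away from it; evaluating the
   summed growth inequality at [ystar], where [A ystar = 0] and hence the
   Lagrangian equals [f], gives the first claim.  For the second,
     [f y(l) - f ystar = - (g lstar - g l) - <l, A (y(l) - ystar)>],
   and Cauchy-Schwarz together with [|A d|^2 <= (2 + 2 cos(pi/m)) |d|^2] reduces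
   it to the first; [2 + 2 cos(pi/m)] is the largest eigenvalue of the Laplacian
   of a path with [m] vertices. *)

Set Implicit Arguments.
Unset Strict Implicit.
Unset Printing Implicit Defensive.

(** * Euclidean geometry of matrices *)

Section EuclideanInnerProduct.
Variables (R : realType) (p q : nat).
Implicit Types u v w : 'M[R]_(p, q).

Lemma edotC u v : edot u v = edot v u.
Proof. by apply: eq_bigr => i _; apply: eq_bigr => j _; rewrite mulrC. Qed.

Lemma edotDr w u v : edot w (u + v) = edot w u + edot w v.
Proof.
rewrite -big_split; apply: eq_bigr => i _ /=; rewrite -big_split.
by apply: eq_bigr => j _ /=; rewrite mxE mulrDr.
Qed.

Lemma edotZr a u v : edot u (a *: v) = a * edot u v.
Proof.
rewrite mulr_sumr; apply: eq_bigr => i _; rewrite mulr_sumr.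
by apply: eq_bigr => j _; rewrite mxE mulrCA.
Qed.

Lemma edotNr u v : edot u (- v) = - edot u v.
Proof. by rewrite -scaleN1r edotZr mulN1r. Qed.

Lemma edotDl w u v : edot (u + v) w = edot u w + edot v w.
Proof. by rewrite !(edotC _ w) edotDr. Qed.

Lemma edotZl a u v : edot (a *: u) v = a * edot u v.
Proof. by rewrite !(edotC _ v) edotZr. Qed.

Lemma edotNl u v : edot (- u) v = - edot u v.
Proof. by rewrite !(edotC _ v) edotNr. Qed.

Definition edotE := (edotDl, edotDr, edotZl, edotZr, edotNl, edotNr).

Lemma edot0r u : edot u 0 = 0.
Proof. by rewrite -(scale0r 0) edotZr mul0r. Qed.

Lemma edot_ge0 u : 0 <= edot u u.
Proof. by do 2!apply: sumr_ge0 => ? _; rewrite -expr2 sqr_ge0. Qed.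

Lemma enorm_sqr u : enorm u ^+ 2 = edot u u.
Proof. by rewrite sqr_sqrtr ?edot_ge0. Qed.

Lemma enorm_ge0 u : 0 <= enorm u.
Proof. exact: sqrtr_ge0. Qed.

Lemma entry_sqr_le_edot u i j : u i j ^+ 2 <= edot u u.
Proof.
rewrite /edot (bigD1 i)//= (bigD1 j)//= -expr2 -addrA lerDl addr_ge0//.
  by apply: sumr_ge0 => k _; rewrite -expr2 sqr_ge0.
by do 2!apply: sumr_ge0 => ? _; rewrite -expr2 sqr_ge0.
Qed.

Lemma edot_eq0 u : edot u u = 0 -> u = 0.
Proof.
move=> u0; apply/matrixP => i j; rewrite mxE; apply/eqP.
by rewrite -sqrf_eq0 eq_le sqr_ge0 andbT -u0 entry_sqr_le_edot.
Qed.

(** Cauchy-Schwarz: [|<v,v> u - <u,v> v|^2] equals [<v,v>] times [<u,u><v,v> - <u,v>^2]. *)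
Lemma normr_edot_le u v : `|edot u v| <= enorm u * enorm v.
Proof.
rewrite -ler_sqr ?nnegrE ?mulr_ge0 ?enorm_ge0//.
rewrite exprMn !enorm_sqr real_normK ?num_real//.
have [v0|v_neq0] := eqVneq (edot v v) 0.
  by rewrite (edot_eq0 v0) !edot0r expr0n /= mulr0.
have vv_gt0 : 0 < edot v v by rewrite lt_def v_neq0 edot_ge0.
have := edot_ge0 (edot v v *: u - edot u v *: v).
rewrite !edotE (edotC v u).
set a := edot u u; set b := edot u v; move: vv_gt0; set c := edot v v => c_gt0.
by move=> h; rewrite -subr_ge0 -(pmulr_rge0 _ c_gt0); lra.
Qed.

(** Links the sup norm, in which compactness is argued, to the Euclidean norm of strong
    convexity. *)
Lemma normr_sqr_le_edot u : `|u| ^+ 2 <= edot u u.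
Proof.
rewrite -enorm_sqr ler_sqr ?nnegrE ?enorm_ge0//.
rewrite /Num.norm/= mx_normrE; apply: bigmax_le; first exact: enorm_ge0.
move=> [i j] _ /=.
rewrite -ler_sqr ?nnegrE ?enorm_ge0// real_normK ?num_real// enorm_sqr.
exact: entry_sqr_le_edot.
Qed.

End EuclideanInnerProduct.

(** * Top eigenvalue of the path Laplacian *)

Section PathLaplacian.
Variable R : realType.

(** The gap between the two sides is the square [(b x + a y)^2 / (a b)]. *)
Lemma sqr_sub_le_weighted (a b x y : R) : 0 < a -> 0 < b ->
  (x - y) ^+ 2 <= (a + b) / a * x ^+ 2 + (a + b) / b * y ^+ 2.
Proof.
move=> a0 b0; rewrite -subr_ge0.
have -> : (a + b) / a * x ^+ 2 + (a + b) / b * y ^+ 2 - (x - y) ^+ 2 =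
    (b * x + a * y) ^+ 2 / (a * b).
  by field; rewrite !gt_eqF.
by rewrite divr_ge0 ?sqr_ge0// mulr_ge0 ?ltW.
Qed.

(** Each edge is bounded by the weighted inequality with weights [v k], [v k.+1]. The two edges at
    vertex [k] then charge [x k ^+ 2] with [w k / v k] and [w k.+1 / v k], which add up to [c]. *)
Lemma path_laplacian_le (N : nat) (x : nat -> R) :
  \sum_(0 <= i < N) (x i - x i.+1) ^+ 2 <=
  (2 + 2 * cos (pi / N.+1%:R)) * \sum_(0 <= i < N.+1) x i ^+ 2.
Proof.
set th := pi / N.+1%:R; set c := 2 + 2 * cos th.
have th_gt0 : 0 < th by rewrite divr_gt0 ?pi_gt0 ?ltr0n.
have thN : th * N.+1%:R = pi by rewrite divfK// pnatr_eq0.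
(* [(-1)^k v k] is the top eigenvector of the path Laplacian, and [v] is
   positive; [w k] is [v (k - 1) + v k], which vanishes for [k = 0] and
   [k = N + 1]. *)
pose v k : R := sin (k%:R * th + th / 2).
pose w k : R := 2 * sin (k%:R * th) * cos (th / 2).
(* In half angles [c = 4 cos(th/2)^2], so [cvE] below is a sum-to-product formula. *)
have cE : cos th = 2 * cos (th / 2) ^+ 2 - 1.
  by rewrite [th in LHS](_ : th = th / 2 *+ 2) ?cos_mulr2n; [ring|field].
have v_gt0 k : (k <= N)%N -> 0 < v k.
  move=> kN; apply: sin_gt0_pi; rewrite -thN.
  have : k%:R * th <= N%:R * th by rewrite ler_pM2r// ler_nat.
  have : 0 <= k%:R * th by rewrite mulr_ge0// ltW.
  by rewrite -(natr1 N) => h1 h2; apply/andP; split; lra.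
have wS k : w k.+1 = v k + v k.+1.
  rewrite /v (_ : k%:R * th + th / 2 = k.+1%:R * th - th / 2).
    by rewrite sinB sinD /w; ring.
  by rewrite -(natr1 k); field.
have cvE k : c * v k = w k + w k.+1.
  rewrite /w (_ : k%:R * th = k%:R * th + th / 2 - th / 2);
    last by rewrite addrK.
  rewrite (_ : k.+1%:R * th = k%:R * th + th / 2 + th / 2).
    by rewrite /v; set a := _ + th / 2; rewrite sinB (sinD a) /c cE; ring.
  by rewrite -(natr1 k); field.
(* Vertex [k] has so far been charged by its left edge only. *)
have main k : (k <= N)%N -> \sum_(0 <= i < k) (x i - x i.+1) ^+ 2 <=
    c * \sum_(0 <= i < k) x i ^+ 2 + w k / v k * x k ^+ 2.
  elim: k => [_|k IH kN].
    by rewrite !big_nil /w !mul0r sin0 !(mulr0, mul0r) addr0.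
  rewrite !big_nat_recr//= mulrDr.
  have vk := v_gt0 _ (ltnW kN); have vk1 := v_gt0 _ kN.
  have := IH (ltnW kN); have := sqr_sub_le_weighted (x k) (x k.+1) vk vk1.
  rewrite -wS.
  have -> : c * x k ^+ 2 = w k / v k * x k ^+ 2 + w k.+1 / v k * x k ^+ 2.
    by rewrite -mulrDl -[_ / _ + _ / _]mulrDl -cvE mulfK// gt_eqF.
  lra.
have wN : w N.+1 = 0 by rewrite /w mulrC [_ * th]mulrC thN sinpi !mulr0.
rewrite [X in _ <= _ * X]big_nat_recr//= mulrDr.
(* The last vertex has no right edge; since [w N.+1 = 0], its left edge alone charges it with
   [c]. *)
rewrite -[X in _ + X * _](_ : w N / v N = c); first exact: main.
by rewrite -[w N]addr0 -wN -cvE mulfK// gt_eqF// v_gt0.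
Qed.

End PathLaplacian.

(** * Minimizing a strongly convex function over a closed convex set *)

Section StronglyConvexMinimization.
Variables (R : realType) (n : nat).
Implicit Types (phi : 'rV[R]_n -> R) (Y : set 'rV[R]_n).

Lemma convex_setP Y : convex_set Y ->
  forall x y t, 0 <= t -> t <= 1 -> Y x -> Y y -> Y (t *: x + (1 - t) *: y).
Proof.
move=> cY x y t t0 t1 Yx Yy.
by have := cY x y (Itv01 t0 t1); rewrite !inE; exact.
Qed.

Lemma edot_conv (x y : 'rV[R]_n) (t : R) :
  edot (t *: x + (1 - t) *: y) (t *: x + (1 - t) *: y) =
  t * edot x x + (1 - t) * edot y y - t * (1 - t) * edot (x - y) (x - y).
Proof. by rewrite !edotE (edotC y x); ring. Qed.

(** The last term is the exact convexity defect of [sigma / 2 * |.|^2], given by [edot_conv]. *)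
Lemma strongly_convexP sigma phi : strongly_convex sigma phi ->
  forall x y t, 0 <= t -> t <= 1 -> phi (t *: x + (1 - t) *: y) <=
    t * phi x + (1 - t) * phi y
      - sigma / 2 * (t * (1 - t) * edot (x - y) (x - y)).
Proof.
move=> cphi x y t t0 t1.
have xT z : (z : convex_lmodType 'rV[R]_n) \in setT by rewrite inE.
have : phi (t *: x + (1 - t) *: y)
      - sigma / 2 * enorm (t *: x + (1 - t) *: y) ^+ 2
    <= t * (phi x - sigma / 2 * enorm x ^+ 2)
       + (1 - t) * (phi y - sigma / 2 * enorm y ^+ 2).
  exact: cphi (Itv01 t0 t1) x y (xT x) (xT y).
rewrite !enorm_sqr edot_conv; lra.
Qed.

Lemma strongly_convexD_edot sigma phi c : strongly_convex sigma phi ->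
  strongly_convex sigma (fun x => phi x + edot c x).
Proof.
move=> cphi t x y xT yT; move: (cphi t x y xT yT); rewrite !convRE.
have -> : edot c (conv t x y) = t%:num * edot c x + (1 - t%:num) * edot c y.
  by rewrite -!edotZr -edotDr.
rewrite /unstable.onem; lra.
Qed.

Lemma edot_continuous (c : 'rV[R]_n) : continuous (fun x => edot c x).
Proof.
apply: continuous_big => [|i _]; first exact: add_continuous.
apply: continuous_big => [|j _]; first exact: add_continuous.
by move=> x; apply: (@cvgMl_tmp R _ (nbhs x)); exact: coord_continuous.
Qed.

Lemma bounded_set_le (A : set 'rV[R]_n) (M : R) :
  (forall y, A y -> `|y| <= M) -> bounded_set A.
Proof.
move=> AM; exists M; split; first exact: num_real.
by move=> r Mr y /AM yM /=; exact: le_trans yM (ltW Mr).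
Qed.

Lemma strongly_convex_sublevel_bounded sigma phi x0 : 0 < sigma ->
  strongly_convex sigma phi -> continuous phi ->
  exists M, forall y, phi y <= phi x0 -> `|y| <= M.
Proof.
move=> sigma_gt0 cphi phi_cont.
pose B := [set y : 'rV[R]_n | `|y - x0| <= 1].
have B_closed : closed B.
  have dist_cont : continuous (fun y : 'rV[R]_n => `|y - x0|).
    move=> y; apply: (@cvg_norm _ _ _ (nbhs y)).
    by apply: (@cvgB _ _ _ (nbhs y)); [exact: cvg_id|exact: cvg_cst].
  exact: (continuous_closedP _).1 dist_cont _ (@closed_le _ 1).
have B_bounded : bounded_set B.
  apply: (@bounded_set_le _ (1 + `|x0|)) => y yB.
  by rewrite -[y](subrK x0) (le_trans (ler_normD _ _))// lerD2r.
have [a _ aP] : exists2 a, a \in B & forall y, y \in B -> phi a <= phi y.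
  apply: EVT_min_rV.
  - by exists x0; rewrite /B /= subrr normr0.
  - exact: bounded_closed_compact.
  - exact: continuous_subspaceT.
(* The radius comes from solving [h2] below for [r]. *)
exists (`|x0| + (1 + 2 * (phi x0 - phi a) / sigma)) => y yx0.
rewrite -[y](subrK x0) addrC (le_trans (ler_normD _ _))// lerD2l.
have ax0 : phi a <= phi x0 by apply: aP; rewrite inE /B /= subrr normr0.
have [le1|gt1] := leP `|y - x0| 1.
  rewrite (le_trans le1)// lerDl divr_ge0 ?mulr_ge0 ?subr_ge0//; exact: ltW.
(* Compare [phi] at [x0], at [y], and at the point of [B] on the segment from
   [x0] to [y]. *)
set r := `|y - x0| in gt1 *.
have r_gt0 : 0 < r by exact: lt_trans gt1.
have t0 : 0 <= r^-1 by rewrite invr_ge0 ltW.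
have t1 : r^-1 <= 1 by rewrite invf_le1// ltW.
have := strongly_convexP cphi y x0 t0 t1.
have ya : phi a <= phi (r^-1 *: y + (1 - r^-1) *: x0).
  apply: aP; rewrite inE /B /=.
  have -> : r^-1 *: y + (1 - r^-1) *: x0 - x0 = r^-1 *: (y - x0).
    by rewrite scalerBl scale1r scalerBr -!addrA; congr (_ + _);
       rewrite addrCA addrN addr0.
  by rewrite normrZ -/r gtr0_norm ?invr_gt0// mulVf// gt_eqF.
move=> h; have {h ya} := le_trans ya h.
have := normr_sqr_le_edot (y - x0); rewrite -/r; set d := edot _ _ => rd h.
have h2 : sigma / 2 * (r - 1) <= phi x0 - phi a.
  (* Here [r^-1 (1 - r^-1) r^2 = r - 1], and [r^2 <= d] compares the two norms. *)
  have h3 : r - 1 <= r^-1 * (1 - r^-1) * d.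
    apply: (@le_trans _ _ (r^-1 * (1 - r^-1) * r ^+ 2)).
      by rewrite le_eqVlt; apply/orP; left; apply/eqP; field; rewrite gt_eqF.
    by rewrite ler_wpM2l// mulr_ge0// subr_ge0.
  have h4 : sigma / 2 * (r - 1) <= sigma / 2 * (r^-1 * (1 - r^-1) * d).
    by rewrite ler_pM2l// divr_gt0.
  have : r^-1 * phi y <= r^-1 * phi x0 by rewrite ler_wpM2l.
  lra.
rewrite -lerBlDl ler_pdivlMr//; lra.
Qed.

Lemma strongly_convex_minimizer sigma phi Y : 0 < sigma ->
  strongly_convex sigma phi -> continuous phi ->
  closed Y -> convex_set Y -> Y !=set0 ->
  exists2 x, Y x & forall y, Y y ->
    phi x + sigma / 2 * edot (y - x) (y - x) <= phi y.
Proof.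
move=> sigma_gt0 cphi phi_cont clY cY [x0 Yx0].
pose A := Y `&` [set y | phi y <= phi x0].
have [x xA xmin] : exists2 x, x \in A & forall y, y \in A -> phi x <= phi y.
  apply: EVT_min_rV.
  - by exists x0; split => /=.
  - apply: bounded_closed_compact.
      have [M MP] :=
        strongly_convex_sublevel_bounded x0 sigma_gt0 cphi phi_cont.
      by apply: (@bounded_set_le _ M) => y [_ /MP].
    apply: closedI => //.
    exact: (continuous_closedP _).1 phi_cont _ (@closed_le _ (phi x0)).
  - exact: continuous_subspaceT.
move: xA; rewrite inE => -[Yx /= xx0]; exists x => // y Yy.
(* Points of [Y] outside [A] have values above [phi x0], hence above [phi x]. *)
have xleY z : Y z -> phi x <= phi z.
  move=> Yz; have [zx0|/ltW x0z] := leP (phi z) (phi x0).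
    by apply: xmin; rewrite inE.
  exact: le_trans x0z.
set d := edot _ _.
(* Minimality against [t y + (1 - t) x] gives the bound with the factor
   [1 - t]; let [t] go to 0. *)
have growth t : 0 < t -> t <= 1 -> sigma / 2 * (1 - t) * d <= phi y - phi x.
  move=> t0 t1; have := strongly_convexP cphi y x (ltW t0) t1; rewrite -/d.
  have := xleY _ (convex_setP cY (ltW t0) t1 Yy Yx).
  move=> h1 h2; rewrite -(ler_pM2l t0); lra.
have d0 : 0 <= d by exact: edot_ge0.
rewrite -lerBrDl; apply/ler_addgt0Pl => e e0.
(* This makes the loss [sigma / 2 * t * d] at most [e]; the [+ 1] covers [d = 0]. *)
pose t := Num.min 1 (e / (sigma * d + 1)).
have K0 : 0 < sigma * d + 1 by rewrite ltr_wpDl// mulr_ge0// ltW.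
have t0 : 0 < t by rewrite lt_min ltr01 divr_gt0.
have t1 : t <= 1 by rewrite ge_min lexx.
have : t <= e / (sigma * d + 1) by rewrite ge_min lexx orbT.
rewrite ler_pdivlMr// => te.
have := growth t t0 t1.
have : 0 <= t * (sigma * d).
  exact: mulr_ge0 (ltW t0) (mulr_ge0 (ltW sigma_gt0) d0).
lra.
Qed.

End StronglyConvexMinimization.

(** * Adjoint and norm of the consensus operator *)

Section ConsensusOperator.
Variables (R : realType) (m n : nat).
Implicit Types (y : 'M[R]_(m, n)) (l : 'M[R]_(m.-1, n)).

(** The signed incidence matrix of the path; its transpose gives the adjoint of [Aop]. *)
Definition Amx : 'M[R]_(m.-1, m) :=
  rowsub (@ord_here m) 1%:M - rowsub (@ord_succ m) 1%:M.

Lemma AopE y : Aop y = Amx *m y.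
Proof.
by rewrite mulmxBl !mul_rowsub_mx mul1mx; apply/matrixP => i j; rewrite !mxE.
Qed.

Lemma AopB y y' : Aop (y - y') = Aop y - Aop y'.
Proof. by rewrite !AopE mulmxBr. Qed.

(** Follows from [<u,v> = tr(u v^T)] and cyclicity of the trace. *)
Lemma edot_Aop l y : edot l (Aop y) = edot (Amx^T *m l) y.
Proof.
have edot_tr p (u v : 'M[R]_(p, n)) : edot u v = \tr (u *m v^T).
  by apply: eq_bigr => i _; rewrite mxE; apply: eq_bigr => j _; rewrite mxE.
by rewrite !edot_tr AopE trmx_mul mulmxA mxtrace_mulC mulmxA.
Qed.

Lemma edot_row p (u v : 'M[R]_(p, n)) :
  edot u v = \sum_i edot (row i u) (row i v).
Proof.
apply: eq_bigr => i _; rewrite /edot big_ord1.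
by apply: eq_bigr => j _; rewrite !mxE.
Qed.

Lemma edot_Aop_le y : (0 < m)%N ->
  edot (Aop y) (Aop y) <= (2 + 2 * cos (pi / m%:R)) * edot y y.
Proof.
case: m y => // N y _; rewrite /edot.
rewrite exchange_big [X in _ * X]exchange_big /= mulr_sumr.
(* The columns decouple. [inord] makes column [j] a sequence on [nat], read only at indices up to
   [N], where it is faithful. *)
apply: ler_sum => j _; have := path_laplacian_le N (fun k => y (inord k) j).
rewrite !big_mkord; congr (_ <= _ * _).
  apply: eq_bigr => i _; rewrite !mxE -expr2; congr ((y _ j - y _ j) ^+ 2).
    by apply/val_inj; rewrite /= inordK// ltnW// ltnS.
  by apply/val_inj; rewrite /= inordK// ltnS.
by apply: eq_bigr => i _; rewrite -expr2 inord_val.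
Qed.

Lemma enorm_Aop_le y : (0 < m)%N ->
  enorm (Aop y) <= Num.sqrt (2 + 2 * cos (pi / m%:R)) * enorm y.
Proof. by move=> m_gt0; rewrite -sqrtrM// ler_wsqrtr ?edot_Aop_le. Qed.

End ConsensusOperator.

(** * Minimizers of the Lagrangian and the dual value *)

Section Dual.
Variables (R : realType) (m n : nat).
Variables (Y : set 'rV[R]_n) (f : 'I_m -> 'rV[R]_n -> R).
Variables (mu_ : 'I_m -> R) (mu : R).
Hypotheses (Yclosed : closed Y) (Yconvex : convex_set Y) (Y0 : Y !=set0).
Hypotheses (mu_gt0 : 0 < mu) (mu_le : forall i, mu <= mu_ i).
Hypothesis fstrong : forall i, strongly_convex (mu_ i) (f i).
Hypothesis fcont : forall i, continuous (f i).

Lemma lagrangian_minimizer l : exists2 yl, Ybar Y yl &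
  forall y, Ybar Y y ->
    lagrangian f l yl + mu / 2 * edot (y - yl) (y - yl) <= lagrangian f l y.
Proof.
pose c := (Amx R m)^T *m l.
pose phi i x := f i x + edot (row i c) x.
have lagrangianE y : lagrangian f l y = \sum_i phi i (row i y).
  by rewrite /lagrangian edot_Aop edot_row big_split.
have /fin_all_exists2[x Yx xmin] i : exists2 x, Y x & forall y, Y y ->
    phi i x + mu_ i / 2 * edot (y - x) (y - x) <= phi i y.
  apply: strongly_convex_minimizer => //.
  - exact: lt_le_trans (mu_le i).
  - exact: strongly_convexD_edot.
  - move=> z; apply: (@cvgD _ _ _ (nbhs z)); first exact: fcont.
    exact: edot_continuous.
exists (\matrix_i x i); first by move=> i; rewrite rowK.
move=> y Yy; rewrite !lagrangianE edot_row mulr_sumr -big_split /=.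
apply: ler_sum => i _; rewrite raddfB /= rowK.
(* Each block constant [mu_ i] is weakened to the common [mu]. *)
apply: le_trans (xmin i _ (Yy i)); rewrite lerD2l ler_wpM2r ?edot_ge0//.
by rewrite ler_pM2r.
Qed.

Lemma dual_argmin l yl : argmin (Ybar Y) (lagrangian f l) yl ->
  dual Y f l = (lagrangian f l yl)%:E.
Proof.
move=> [Yyl ylmin]; apply/le_anti/andP; split.
  by apply: ereal_inf_lbound; exists yl.
by apply: le_ereal_inf_tmp => _ [y Yy <-]; rewrite lee_fin ylmin.
Qed.

End Dual.

(** * The two primal estimates from the dual gap *)

Theorem lemma8 (R : realType) (m n : nat) (hm : (2 <= m)%N) (hn : (1 <= n)%N)
    (Y : set 'rV[R]_n) (Yclosed : closed Y) (Yconvex : convex_set Y)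
    (f : 'I_m -> 'rV[R]_n -> R)
    (fstrict : forall i, strictly_convex (f i))
    (fclosed : forall i, closed_function (f i))
    (mu_ : 'I_m -> R) (mu_gt0 : forall i, 0 < mu_ i)
    (fstrong : forall i, strongly_convex (mu_ i) (f i))
    (fdiff : forall i x, differentiable (f i) x)
    (ystar : 'M[R]_(m, n)) (lstar : 'M[R]_(m.-1, n))
    (primal_attained : argmin (feasible Y) (fsum f) ystar)
    (dual_attained : argmax setT (dual Y f) lstar)
    (strong_duality : (fsum f ystar)%:E = dual Y f lstar) :
  let mu := \big[Num.min/mu_ (Ordinal (ltnW hm))]_(i < m) mu_ i in
  let S := Num.sqrt ((4 + 4 * cos (pi / m%:R)) / mu) in
  let g := dual Y f in
  forall l : 'M[R]_(m.-1, n),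
    exists2 yl : 'M[R]_(m, n), argmin (Ybar Y) (lagrangian f l) = [set yl] &
      ((mu / 2 * enorm (yl - ystar) ^+ 2)%:E <= g lstar - g l)%E /\
      ((`|fsum f yl - fsum f ystar|)%:E <=
         g lstar - g l + (S * enorm l)%:E * sqrte (g lstar - g l))%E.
Proof.
move=> mu S g l.
have [[Yystar /= Aystar] _] := primal_attained.
have mu_le i : mu <= mu_ i by exact: bigmin_le.
have mu0 : 0 < mu.
  by rewrite /mu; elim/big_ind : _ => // a b a0 b0; rewrite lt_min a0.
have fcont i : continuous (f i).
  by move=> x; exact: differentiable_continuous (fdiff i x).
have Y0 : Y !=set0 by exists (row (Ordinal (ltnW hm)) ystar); exact: Yystar.
have [yl Yyl growth] :=
  lagrangian_minimizer Yclosed Yconvex Y0 mu0 mu_le fstrong fcont l.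
have ylmin y : Ybar Y y -> lagrangian f l yl <= lagrangian f l y.
  move=> /growth; apply: le_trans; rewrite lerDl mulr_ge0 ?edot_ge0//.
  by rewrite divr_ge0// ltW.
exists yl.
  (* Uniqueness: quadratic growth leaves a second minimizer at distance zero from [yl]. *)
  apply/seteqP; split => [y [Yy ymin]|_ ->]; last by split.
  have := le_trans (growth _ Yy) (ymin _ Yyl).
  rewrite gerDl pmulr_rle0 ?divr_gt0// => d0; apply/subr0_eq/edot_eq0.
  by apply/le_anti; rewrite d0 edot_ge0.
(* Both dual values are finite, so the extended-real claims become real ones about the gap [D]. *)
rewrite /g -strong_duality (@dual_argmin _ _ _ _ _ _ yl)// -EFinB /=.
rewrite -EFinM -EFinD !lee_fin.
set D := fsum f ystar - lagrangian f l yl.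
have dD : mu / 2 * enorm (yl - ystar) ^+ 2 <= D.
  rewrite enorm_sqr -opprB edotNl edotNr opprK lerBrDl.
  by rewrite (le_trans (growth _ Yystar))// /lagrangian Aystar edot0r addr0.
split=> //.
have -> : fsum f yl - fsum f ystar = - (D + edot l (Aop (yl - ystar))).
  by rewrite AopB Aystar subr0 /D /lagrangian; ring.
have D0 : 0 <= D.
  by apply: le_trans dD; rewrite mulr_ge0 ?sqr_ge0// divr_ge0 ?ltW.
rewrite normrN (le_trans (ler_normD _ _))// ger0_norm// lerD2l.
rewrite (le_trans (normr_edot_le _ _))// [S * _]mulrC -mulrA.
rewrite ler_wpM2l ?enorm_ge0// (le_trans (enorm_Aop_le _ (ltnW hm)))//.
(* The first factor of [S^2] bounds the operator; by [dD], [2 / mu * D] bounds [|yl - ystar|^2]. *)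
rewrite /S (_ : (4 + _) / mu = (2 + 2 * cos (pi / m%:R)) * (2 / mu));
  last by ring.
rewrite sqrtrM// -mulrA ler_wpM2l ?sqrtr_ge0//.
rewrite -sqrtrM ?divr_ge0// ?(ltW mu0)// ler_wsqrtr// mulrAC ler_pdivlMr//.
by move: dD; rewrite enorm_sqr; lra.
Qed.
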